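(* There exists a tile set $\tau$ such that $\tau$-tilings exist and every $\tau$-tiling is $\alpha$-aperiodic for every real $\alpha<1/3$.
   Context: Fix a finite set $C$ of colors. A tile is a quadruple $(\ell,r,t,b)\in C^4$ (left, right, top, bottom colors); a tile set is a finite subset $\tau\subset C^4$. A $\tau$-tiling is a map $U\colon\mathbb{Z}^2\to\tau$ such that the right color of $U(x,y)$ equals the left color of $U(x+1,y)$ and the top color of $U(x,y)$ equals the bottom color of $U(x,y+1)$ for all $(x,y)$. For a real $\alpha>0$ and a finite set $A$, a map $U\colon\mathbb{Z}^2\to A$ is $\alpha$-aperiodic if for every nonzero $T\in\mathbb{Z}^2$ there exists $N$ such that in every (axis-parallel) square of lattice points with side at least $N$, the fraction of points $x$ in the square with $U(x)\neq U(x+T)$ exceeds $\alpha$. A $\tau$-tiling is regarded as a map $\mathbb{Z}^2\to\tau$ for this definition. *)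

(* Defs.v *)
From HB Require Import structures.
From mathcomp Require Import all_boot all_order all_algebra.
From mathcomp Require Import reals.

Set Implicit Arguments.
Unset Strict Implicit.
Unset Printing Implicit Defensive.

Import Order.TTheory GRing.Theory Num.Theory.
Local Open Scope ring_scope.

Definition plane : Type := (int * int)%type.

(* A tile is ordered (left, right, top, bottom). *)
Definition tile (C : Type) : Type := (C * C * C * C)%type.

Definition left_color (C : Type) (t : tile C) : C := t.1.1.1.
Definition right_color (C : Type) (t : tile C) : C := t.1.1.2.
Definition top_color (C : Type) (t : tile C) : C := t.1.2.
Definition bottom_color (C : Type) (t : tile C) : C := t.2.

Definition is_tiling (C : finType) (tau : {set tile C})
    (U : plane -> tile C) : Prop :=
  [/\ forall p : plane, U p \in tau,
      forall x y : int, right_color (U (x, y)) = left_color (U (x + 1, y))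
    & forall x y : int, top_color (U (x, y)) = bottom_color (U (x, y + 1))].

(* The square of side n with lower left corner a consists of the n ^ 2 points
   a + (i, j) with 0 <= i, j < n. *)
Definition square_point (a : plane) (n : nat) (ij : 'I_n * 'I_n) : plane :=
  (a.1 + (ij.1 : nat)%:Z, a.2 + (ij.2 : nat)%:Z).

Definition translate (T p : plane) : plane := (p.1 + T.1, p.2 + T.2).

Definition mismatch_fraction (R : realType) (A : finType) (U : plane -> A)
    (T a : plane) (n : nat) : R :=
  #|[set ij : 'I_n * 'I_n |
      U (square_point a ij) != U (translate T (square_point a ij))]|%:R
    / (n ^ 2)%:R.

(* The notion is meant for alpha > 0. *)
Definition aperiodic (R : realType) (A : finType) (alpha : R)
    (U : plane -> A) : Prop :=
  forall T : plane, T <> (0, 0) ->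
  exists N : nat, forall (n : nat) (a : plane), (N <= n)%N ->
    alpha < mismatch_fraction R U T a n.

(* Main.v *)
(** A hierarchical tile set in the style of Ollinger, with 3 x 3 blocks and a
    conserved bit.  Every tile knows its position modulo 3, and wires run along
    the rows and columns of position 0; the wires leaving the corner (0, 0) of a
    block are the four sides of a macro-tile, whose own position and bit are
    shared by the wires inside the block.  The local rules say exactly that the
    macro-tiles obey the same local rules, so every tiling is an infinite
    hierarchy of blocks of side 3 ^ k.

    The bit of a tile is the bit of its macro-tile plus a fixed bit [twist]
    depending on its position.  Hence a translation by 3 ^ k T compares the bits
    of the macro-tiles of level k up to a common twist, and it suffices to treat
    T not divisible by 3: then at least 3 of the 9 tiles of each block differ
    from their translates, whatever the bits of the at most four macro-tiles
    that the translated block meets. *)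

Require Import Defs.
From HB Require Import structures.
From mathcomp Require Import all_boot all_order all_algebra.
From mathcomp Require Import reals.
From mathcomp Require Import zify ring lra.

Set Implicit Arguments.
Unset Strict Implicit.
Unset Printing Implicit Defensive.

Import Order.TTheory GRing.Theory Num.Theory.
Local Open Scope ring_scope.

(* A cell is a position in the parent block with the conserved bit; a wire is
   labelled by the position of its initial (left or bottom) end in the block where
   it is interior, followed by the cell of that block.  The color of an edge
   consists of the cells of the two tiles sharing it (left and right, or bottom
   and top) and of the wire crossing it. *)
Definition pos : finType := ('Z_3 * 'Z_3)%type.
Definition cell : finType := (pos * bool)%type.
Definition wire : finType := (pos * cell)%type.
Definition color : finType := (cell * cell * wire)%type.

(* Found by exhaustive search, so that [twist_mismatch] holds and
   [twist 1 1 = false], which makes the central position a fixed point. *)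
Definition twist (i j : nat) : bool :=
  (i, j) \in [:: (1, 2); (2, 0); (2, 2)]%N.

Definition parent_bit (x : cell) : bool := x.2 (+) twist x.1.1 x.1.2.

(* [f] is the vertical wire starting at [b], which separates [a] from [b]; the two
   cells are siblings, and [f] interior to their parent, unless [b] is in column 0. *)
Definition link_h (a b : cell) (f : wire) : bool :=
  (b.1 == (a.1.1 + 1, a.1.2)) &&
  ((b.1.1 != 0) ==>
    [&& f.1 == b.1, f.2.2 == parent_bit b & parent_bit a == parent_bit b]).

Definition link_v (a b : cell) (f : wire) : bool :=
  (b.1 == (a.1.1, a.1.2 + 1)) &&
  ((b.1.2 != 0) ==>
    [&& f.1 == b.1, f.2.2 == parent_bit b & parent_bit a == parent_bit b]).

(* On row 0 a horizontal wire of a higher level passes through the tile: [ft.2]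
   and [fb.2] are then the macro-cells above and below it, so [link_v] is
   imposed one level up; symmetrically on column 0. *)
Definition core (p : pos) (fl fr ft fb : wire) : bool :=
  [&& p != (0, 0),
      (p.2 != 0) ==> (fr.1 == p) && (fl.1 == (p.1 - 1, p.2)),
      (p.1 != 0) ==> (ft.1 == p) && (fb.1 == (p.1, p.2 - 1)) &
      if p.2 == 0 then (fl == fr) && link_v fb.2 ft.2 fr
      else if p.1 == 0 then (ft == fb) && link_h fl.2 fr.2 ft
      else [&& fl.2 == fr.2, ft.2 == fr.2 & fb.2 == fr.2]].

(* A tile at position (0, 0) stands for the macro-tile of its block, whose wires
   are those of some tile outside position (0, 0), at a possibly higher level. *)
Definition quad (p : pos) (fl fr ft fb : wire) : bool :=
  if p == (0, 0) then [exists p', core p' fl fr ft fb] else core p fl fr ft fb.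

Definition tau : {set tile color} :=
  [set t : tile color |
    let x := (right_color t).1.1 in
    [&& (left_color t).1.2 == x, (top_color t).1.1 == x,
        (bottom_color t).1.2 == x,
        link_h (left_color t).1.1 x (top_color t).2,
        link_v (bottom_color t).1.1 x (right_color t).2 &
        quad x.1 (left_color t).2 (right_color t).2
          (top_color t).2 (bottom_color t).2]].

(** * Tilings as fields of cells and wires *)

(** [h i j] and [v i j] leave the tile through its right and top edges; the wires entering it leave
    its left and lower neighbours. *)
Definition good (x : int -> int -> cell) (h v : int -> int -> wire) : Prop :=
  forall i j,
    [/\ link_h (x (i - 1) j) (x i j) (v i j),
        link_v (x i (j - 1)) (x i j) (h i j)
      & quad (x i j).1 (h (i - 1) j) (h i j) (v i j) (v i (j - 1))].

Lemma tiling_good (U : plane -> tile color) : is_tiling tau U ->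
  exists x h v, good x h v /\
    forall i j, (right_color (U (i, j))).1.1 = x i j.
Proof.
case=> Utau Uh Uv.
exists (fun i j => (right_color (U (i, j))).1.1),
  (fun i j => (right_color (U (i, j))).2), (fun i j => (top_color (U (i, j))).2).
split=> // i j.
have := Utau (i, j); rewrite inE /= => /and5P[_ _ _ lh /andP[lv q]].
have El : left_color (U (i, j)) = right_color (U (i - 1, j)).
  by rewrite Uh subrK.
have Eb : bottom_color (U (i, j)) = top_color (U (i, j - 1)).
  by rewrite Uv subrK.
have := Utau (i, j - 1); rewrite inE /= => /and5P[_ /eqP Et _ _ _].
by rewrite -Et -El -Eb.
Qed.

Lemma good_tiling x h v : good x h v -> exists U, is_tiling tau U.
Proof.
move=> G.
exists (fun p => ((x (p.1 - 1) p.2, x p.1 p.2, h (p.1 - 1) p.2),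
                  (x p.1 p.2, x (p.1 + 1) p.2, h p.1 p.2),
                  (x p.1 p.2, x p.1 (p.2 + 1), v p.1 p.2),
                  (x p.1 (p.2 - 1), x p.1 p.2, v p.1 (p.2 - 1)))).
split=> [[i j]|i j|i j].
- by rewrite inE /= !eqxx /=; case: (G i j) => -> -> ->.
- by rewrite /right_color /left_color /= addrK.
- by rewrite /top_color /bottom_color /= addrK.
Qed.

Lemma good_translate x h v a b : good x h v ->
  good (fun i j => x (i + a) (j + b)) (fun i j => h (i + a) (j + b))
    (fun i j => v (i + a) (j + b)).
Proof. by move=> G i j; rewrite (addrAC i) (addrAC j); apply: G. Qed.

(** * Desubstitution: the macro-tiles of a tiling *)

Lemma int_ind1 (P : int -> Prop) :
  P 0 -> (forall i, P (i - 1) <-> P i) -> forall i, P i.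
Proof.
move=> P0 PS; elim/int_rect=> // n.
  by move=> Pn; apply/PS; rewrite -addn1 PoszD addrK.
by move=> /PS; rewrite -opprD -PoszD addn1.
Qed.

Lemma good_pos x h v i j : good x h v ->
  (x i j).1 = ((x 0 0).1.1 + i%:~R, (x 0 0).1.2 + j%:~R).
Proof.
move=> G.
have Sh i' j' : (x i' j').1 = ((x (i' - 1) j').1.1 + 1, (x (i' - 1) j').1.2).
  by case: (G i' j') => /andP[/eqP].
have Sv i' j' : (x i' j').1 = ((x i' (j' - 1)).1.1, (x i' (j' - 1)).1.2 + 1).
  by case: (G i' j') => _ /andP[/eqP].
suff [E1 E2] : (x i j).1.1 = (x 0 0).1.1 + i%:~R /\
               (x i j).1.2 = (x 0 0).1.2 + j%:~R.
  by rewrite [LHS]surjective_pairing E1 E2.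
move: i j; elim/int_ind1=> [|i].
  elim/int_ind1=> [|j]; first by rewrite !addr0.
  rewrite (Sv 0 j) /= rmorphB /= !addrA; split=> -[-> E]; split=> //.
    by rewrite E subrK.
  by rewrite -E addrK.
split=> H j; move: (H j); rewrite (Sh i j) /= rmorphB /= addrA.
  by move=> [-> ->]; rewrite subrK.
by move=> [<- ->]; rewrite addrK.
Qed.

Lemma intr_Z3 (q : int) (r : nat) : (3 * q + r%:Z)%:~R = r%:R :> 'Z_3.
Proof.
by rewrite rmorphD rmorphM /= (_ : 3%:~R = 0 :> 'Z_3) ?mul0r ?add0r //; apply/val_inj.
Qed.

(** The labels on wires pin down the witness hidden in [quad]: where [p] prescribes two opposite
    labels they differ, whereas a [p'] that lets a wire pass there makes them equal. *)
Lemma core_pos p p' fl fr ft fb :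
  core p' fl fr ft fb -> p != (0, 0) ->
  (p.2 != 0 -> fr.1 = p /\ fl.1 = (p.1 - 1, p.2)) ->
  (p.1 != 0 -> ft.1 = p /\ fb.1 = (p.1, p.2 - 1)) -> p' = p.
Proof.
case/and4P=> p'0 /implyP Hh /implyP Hv Hc p0 Lh Lv.
have N1 (a : 'Z_3) : a != a - 1.
  by rewrite eq_sym -subr_eq0 addrAC subrr add0r oppr_eq0.
have [p20|p20] := eqVneq p.2 0; last have [E1 E2] := Lh p20.
  have p10 : p.1 != 0.
    by apply: contraNneq p0 => p10; rewrite [p]surjective_pairing p10 p20.
  have [E1 E2] := Lv p10.
  have [p'10|p'10] := eqVneq p'.1 0; last first.
    by have /andP[/eqP <- _] := Hv p'10.
  have p'20 : p'.2 != 0.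
    by apply: contraNneq p'0 => p'20; rewrite [p']surjective_pairing p'10 p'20.
  move: Hc; rewrite (negPf p'20) p'10 eqxx => /andP[/eqP E _].
  move: E2; rewrite -E E1 => /(congr1 snd)/= /eqP.
  by rewrite (negPf (N1 _)).
have [p'20|p'20] := eqVneq p'.2 0; last first.
  by have /andP[/eqP <- _] := Hh p'20.
move: Hc; rewrite p'20 eqxx => /andP[/eqP E _].
move: E2; rewrite E E1 => /(congr1 fst)/= /eqP.
by rewrite (negPf (N1 _)).
Qed.

Lemma intr_Z3_neq0 (q : int) (r : nat) :
  (0 < r < 3)%N -> (3 * q + r%:Z)%:~R != 0 :> 'Z_3.
Proof. by rewrite intr_Z3; case: r => [|[|[|r]]]. Qed.

(** Horizontal wires off row 0 and vertical wires off column 0 all carry the macro-cell of their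
    block, read here at position (1, 1). Those along row 0 and column 0 cross the block unchanged
    and serve as macro-wires. *)
Lemma desubstitute_aligned x h v : good x h v ->
  (forall i j, (x i j).1 = (i%:~R, j%:~R)) ->
  let x' (i j : int) := (h (3 * i + 1%:Z) (3 * j + 1%:Z)).2 in
  good x' (fun i j => h (3 * i) (3 * j)) (fun i j => v (3 * i) (3 * j)) /\
  forall i j (r s : nat), (r < 3)%N -> (s < 3)%N ->
    (x (3 * i + r%:Z) (3 * j + s%:Z)).2 = (x' i j).2 (+) twist r s.
Proof.
move=> G P x'.
have GI i j : i%:~R != 0 :> 'Z_3 -> j%:~R != 0 :> 'Z_3 ->
    [/\ (h (i - 1) j).2 = (h i j).2, (v i j).2 = (h i j).2
      & (v i (j - 1)).2 = (h i j).2].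
  move=> i0 j0; case: (G i j) => _ _; rewrite P /quad xpair_eqE (negPf i0) /=.
  by rewrite /core /= (negPf i0) (negPf j0) => /and4P[_ _ _ /and3P[/eqP-> /eqP-> /eqP->]].
have GH i j : i%:~R != 0 :> 'Z_3 -> j%:~R = 0 :> 'Z_3 ->
    h (i - 1) j = h i j /\ link_v (v i (j - 1)).2 (v i j).2 (h i j).
  move=> i0 j0; case: (G i j) => _ _; rewrite P /quad xpair_eqE (negPf i0) /=.
  by rewrite /core /= j0 eqxx => /and4P[_ _ _ /andP[/eqP-> ->]].
have GV i j : i%:~R = 0 :> 'Z_3 -> j%:~R != 0 :> 'Z_3 ->
    v i j = v i (j - 1) /\ link_h (h (i - 1) j).2 (h i j).2 (v i j).
  move=> i0 j0; case: (G i j) => _ _.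
  rewrite P /quad xpair_eqE (negPf j0) andbF /=.
  by rewrite /core /= i0 (negPf j0) eqxx => /and4P[_ _ _ /andP[/eqP-> ->]].
have LH i j : i%:~R != 0 :> 'Z_3 -> (v i j).2.2 = parent_bit (x i j) /\
    parent_bit (x (i - 1) j) = parent_bit (x i j).
  move=> i0; case: (G i j) => + _ _; rewrite /link_h P /= i0.
  by case/and4P => _ _ /eqP -> /eqP ->.
have LV i j : j%:~R != 0 :> 'Z_3 -> (h i j).2.2 = parent_bit (x i j).
  move=> j0; case: (G i j) => _ + _; rewrite /link_v P /= j0.
  by case/and4P => _ _ /eqP -> /eqP.
have sub1 (i : int) (r : nat) : 3 * i + r.+1%:Z - 1 = 3 * i + r%:Z by lia.
have sub3 (i : int) : 3 * i - 1 = 3 * (i - 1) + 2%:Z by lia.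
have add0 (i : int) : 3 * i = 3 * i + 0%:Z by rewrite addr0.
have Z0 (i : int) : (3 * i)%:~R = 0 :> 'Z_3 by rewrite add0 intr_Z3.
have N1 (i : int) : (3 * i + 1%:Z)%:~R != 0 :> 'Z_3 by apply: intr_Z3_neq0.
have N2 (i : int) : (3 * i + 2%:Z)%:~R != 0 :> 'Z_3 by apply: intr_Z3_neq0.
have hD (i j : int) r s : (r < 3)%N -> (0 < s < 3)%N ->
    (h (3 * i + r%:Z) (3 * j + s%:Z)).2 = x' i j.
  move=> r3 s3.
  have [I1 _ _] := GI (3 * i + 1%:Z) (3 * j + s%:Z)
    (N1 _) (intr_Z3_neq0 _ s3).
  have [I2 _ _] := GI (3 * i + 2%:Z) (3 * j + s%:Z)
    (N2 _) (intr_Z3_neq0 _ s3).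
  have -> : (h (3 * i + r%:Z) (3 * j + s%:Z)).2 =
      (h (3 * i + 1%:Z) (3 * j + s%:Z)).2.
    by rewrite !sub1 in I1 I2; case: r r3 => [|[|[|]]] // _; rewrite ?I2.
  have [_ J1 _] := GI (3 * i + 1%:Z) (3 * j + 1%:Z) (N1 _) (N1 _).
  have [_ _ J2] := GI (3 * i + 1%:Z) (3 * j + 2%:Z) (N1 _) (N2 _).
  rewrite sub1 J1 in J2; by case: s s3 {I1 I2} => [|[|[|]]] // _; rewrite -?J2.
have vD (i j : int) r s : (0 < r < 3)%N -> (s < 3)%N ->
    (v (3 * i + r%:Z) (3 * j + s%:Z)).2 = x' i j.
  move=> r3; have r3' : (r < 3)%N by case/andP: r3.
  case: s => [|s] s3.
    have [_ _] := GI (3 * i + r%:Z) (3 * j + 1%:Z) (intr_Z3_neq0 _ r3) (N1 _).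
    by rewrite sub1 => ->; apply: hD.
  have [_ -> _] := GI (3 * i + r%:Z) (3 * j + s.+1%:Z) (intr_Z3_neq0 _ r3)
    (@intr_Z3_neq0 j s.+1 s3).
  exact: hD.
have pass_h i j (r : nat) : (r < 3)%N -> h (3 * i + r%:Z) (3 * j) = h (3 * i) (3 * j).
  have [H1 _] := GH (3 * i + 1%:Z) (3 * j) (N1 _) (Z0 _).
  have [H2 _] := GH (3 * i + 2%:Z) (3 * j) (N2 _) (Z0 _).
  rewrite !sub1 -?add0 in H1 H2.
  by case: r => [|[|[|]]] // _; rewrite -?H2 -?H1 -?add0.
have pass_v i j (s : nat) : (s < 3)%N -> v (3 * i) (3 * j + s%:Z) = v (3 * i) (3 * j).
  have [H1 _] := GV (3 * i) (3 * j + 1%:Z) (Z0 _) (N1 _).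
  have [H2 _] := GV (3 * i) (3 * j + 2%:Z) (Z0 _) (N2 _).
  rewrite !sub1 -?add0 in H1 H2.
  by case: s => [|[|[|]]] // _; rewrite ?H2 ?H1 -?add0.
(* The tile at position (0, 1) has the macro-cells of both blocks on its left and right wires. *)
have newh i j : link_h (x' (i - 1) j) (x' i j) (v (3 * i) (3 * j)).
  have [_] := GV (3 * i) (3 * j + 1%:Z) (Z0 _) (N1 _).
  by rewrite sub3 pass_v // hD // {1}[3 * i]add0 hD.
have newv i j : link_v (x' i (j - 1)) (x' i j) (h (3 * i) (3 * j)).
  have [_] := GH (3 * i + 1%:Z) (3 * j) (N1 _) (Z0 _).
  by rewrite sub3 pass_h // vD // {1}[3 * j]add0 vD.
split=> [i j|i j r s r3 s3].
  split=> //.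
  have : quad (0, 0) (h (3 * (i - 1)) (3 * j)) (h (3 * i) (3 * j))
      (v (3 * i) (3 * j)) (v (3 * i) (3 * (j - 1))).
    have <- : h (3 * i - 1) (3 * j) = h (3 * (i - 1)) (3 * j).
      by rewrite sub3 pass_h.
    have <- : v (3 * i) (3 * j - 1) = v (3 * i) (3 * (j - 1)).
      by rewrite sub3 pass_v.
    have [_ _] := G (3 * i) (3 * j).
    by rewrite P !Z0.
  have [->//|p0] := eqVneq (x' i j).1 (0, 0).
  rewrite /quad eqxx (negPf p0) => /existsP[p' Hp'].
  suff <- : p' = (x' i j).1 by [].
  (* The labels come from [newv] at the block and its left neighbour, or from [newh] at the block
     and its lower neighbour. *)
  apply: (core_pos Hp' p0) => [p2|p1].
    have /andP[/eqP Eh _] := newh i j.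
    have /andP[_ /implyP/(_ p2)/and3P[/eqP-> _ _]] := newv i j.
    have /andP[_ /implyP] := newv (i - 1) j.
    rewrite Eh /= in p2 *; rewrite p2 => /(_ isT)/and3P[/eqP-> _ _].
    by rewrite addrK -surjective_pairing.
  have /andP[/eqP Ev _] := newv i j.
  have /andP[_ /implyP/(_ p1)/and3P[/eqP-> _ _]] := newh i j.
  have /andP[_ /implyP] := newh i (j - 1).
  rewrite Ev /= in p1 *; rewrite p1 => /(_ isT)/and3P[/eqP-> _ _].
  by rewrite addrK -surjective_pairing.
suff : parent_bit (x (3 * i + r%:Z) (3 * j + s%:Z)) = (x' i j).2.
  rewrite /parent_bit P /= !intr_Z3 => <-.
  by case: r r3 s s3 => [|[|[|]]] // _ [|[|[|]]] // _; rewrite addbK.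
(* Off row 0 the horizontal wire gives the parent bit; on row 0 the vertical one does, except at the
   corner, which is compared with its right sibling. *)
case: s s3 => [|s] s3; last by rewrite -LV ?hD ?intr_Z3_neq0.
case: r r3 => [|r] r3.
  have [F E] := LH (3 * i + 1%:Z) (3 * j + 0%:Z) (N1 _).
  by rewrite sub1 in E; rewrite E -F vD.
by have [<- _] := LH (3 * i + r.+1%:Z) (3 * j + 0%:Z)
  (@intr_Z3_neq0 i r.+1 r3); rewrite vD.
Qed.

Lemma recentre_Z3 (c : 'Z_3) (i : int) :
  c + (i + (nat_of_ord (- c))%:Z)%:~R = i%:~R.
Proof.
have E : (nat_of_ord (- c))%:Z%:~R = - c :> 'Z_3 by exact: natr_Zp.
by rewrite rmorphD /= E addrCA subrr addr0.
Qed.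

(** Only bits are recorded, since mismatches are counted on bits; [(a, b)] is the origin of the grid
    of blocks. *)
Definition refines (x x' : int -> int -> cell) (a b : int) : Prop :=
  forall i j (r s : nat), (r < 3)%N -> (s < 3)%N ->
    (x (3 * i + r%:Z + a) (3 * j + s%:Z + b)).2 = (x' i j).2 (+) twist r s.

Lemma desubstitute x h v : good x h v ->
  exists a b x' h' v', good x' h' v' /\ refines x x' a b.
Proof.
move=> G.
pose a := (nat_of_ord (- (x 0 0).1.1))%:Z.
pose b := (nat_of_ord (- (x 0 0).1.2))%:Z.
have [|G' E] := desubstitute_aligned (good_translate a b G).
  by move=> i j; rewrite (good_pos _ _ G) !recentre_Z3.
by exists a, b; do 3!eexists; split; [exact: G'|exact: E].
Qed.

(** * Counting on squares by blocks *)

Lemma sum_ord_mul (m n : nat) (F : nat -> nat) :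
  (\sum_(i < m * n) F i = \sum_(i < n) \sum_(k < m) F (m * i + k))%N.
Proof.
elim: n => [|n IH]; first by rewrite muln0 !big_ord0.
by rewrite mulnSr big_split_ord IH big_ord_recr.
Qed.

Lemma leq_sum_shift (m n r : nat) (F : nat -> nat) : (r + m <= n)%N ->
  (\sum_(i < m) F (r + i)%N <= \sum_(i < n) F i)%N.
Proof.
move/subnKC <-; rewrite -addnA big_split_ord /= addnC.
rewrite [X in (_ <= X + _)%N]big_split_ord /= -addnA; exact: leq_addr.
Qed.

Definition square_sum (f : int -> int -> bool) (p q : int) (n : nat) : nat :=
  (\sum_(i < n) \sum_(j < n) f (p + i%:Z)%R (q + j%:Z)%R)%N.

(** Fewer than [M] points precede the first one congruent to [a], so giving up one of the [n %/ M]
    blocks is enough for alignment. *)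
Lemma first_multiple (p a : int) (M n : nat) : (0 < M <= n)%N ->
  exists (u : int) (r : nat),
    p + r%:Z = M%:Z * u + a /\ (r + M * (n %/ M).-1 <= n)%N.
Proof.
case/andP=> M0 Mn.
have M0' : M%:Z != 0 by rewrite eqz_nat -lt0n.
have r0 := modz_ge0 (a - p) M0'.
have rM : ((a - p) %% M%:Z)%Z < M%:Z by rewrite ltz_pmod.
have E := divz_eq (a - p) M%:Z.
exists (- ((a - p) %/ M%:Z)%Z), `|((a - p) %% M%:Z)%Z|%N; split.
  by rewrite gez0_abs //; move: E; set d := (_ %/ _)%Z; set r := (_ %% _)%Z; lia.
have := leq_trunc_div n M; have : (0 < n %/ M)%N by rewrite divn_gt0.
case: (n %/ M)%N => // w _ /=.
by rewrite mulSn mulnC; apply: leq_trans; rewrite leq_add2r; lia.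
Qed.

Lemma square_sum_blocks f (M K : nat) (a b : int) :
  (forall u w, (K <= square_sum f (M%:Z * u + a) (M%:Z * w + b) M)%N) ->
  forall p q n, (0 < M <= n)%N ->
    ((n %/ M).-1 * (n %/ M).-1 * K <= square_sum f p q n)%N.
Proof.
move=> HK p q n Mn.
have [u [r [Er Hr]]] := first_multiple p a Mn.
have [w [s [Es Hs]]] := first_multiple q b Mn.
set W := (n %/ M).-1 in Hr Hs *.
apply: leq_trans (leq_sum_shift (fun i => \sum_(j < n) f (p + i%:Z)%R (q + j%:Z)%R)%N Hr).
apply: (@leq_trans (\sum_(i < M * W) \sum_(j < M * W)
    f (p + (r + i)%N%:Z)%R (q + (s + j)%N%:Z)%R)%N); last first.
  apply: leq_sum => i _.
  exact: (leq_sum_shift (fun j => f (p + (r + i)%N%:Z)%R (q + j%:Z)%R : nat) Hs).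
rewrite (sum_ord_mul _ _ (fun i => \sum_(j < M * W)
    f (p + (r + i)%N%:Z)%R (q + (s + j)%N%:Z)%R)%N).
have -> : (W * W * K = \sum_(i < W) \sum_(j < W) K)%N.
  by rewrite !sum_nat_const !card_ord mulnA.
apply: leq_sum => i _.
under [X in (_ <= X)%N]eq_bigr => k _ do rewrite (sum_ord_mul _ _ (fun j =>
    f (p + (r + (M * i + k))%N%:Z)%R (q + (s + j)%N%:Z)%R : nat)).
rewrite exchange_big; apply: leq_sum => j _.
apply: leq_trans (HK (u + i%:Z) (w + j%:Z)) _.
rewrite /square_sum; apply/eq_leq/eq_bigr => k _; apply: eq_bigr => l _.
congr (nat_of_bool (f _ _)).
  by rewrite !PoszD PoszM !addrA Er; ring.
by rewrite !PoszD PoszM !addrA Es; ring.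
Qed.

(** * Density of mismatches *)

Definition bit_mismatch (x : int -> int -> cell) (t1 t2 i j : int) : bool :=
  (x i j).2 != (x (i + t1) (j + t2)).2.

(** A finite check: [i + r] and [j + s] are at most 4, so [d] is evaluated on indices 0 and 1 only,
    leaving 32 choices of bits for each of the 8 shifts. *)
Lemma twist_mismatch (r s : nat) (e : bool) (d : nat -> nat -> bool) :
  (r < 3)%N -> (s < 3)%N -> (r, s) != (0, 0)%N ->
  (3 <= \sum_(i < 3) \sum_(j < 3)
     (e (+) twist i j != d ((i + r) %/ 3) ((j + s) %/ 3) (+)
                         twist ((i + r) %% 3) ((j + s) %% 3)))%N.
Proof.
move=> r3 s3 rs0; rewrite !big_ord_recl !big_ord0 /=.
case: r r3 s s3 rs0 => [|[|[|]]] // _ [|[|[|]]] // _ _;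
  rewrite /twist /=; case: e (d 0 0)%N (d 0 1)%N (d 1 0)%N (d 1 1)%N => [] [] [] [] [] //.
Qed.

Lemma mismatch_block x x' a b (t1 t2 u w : int) :
  refines x x' a b -> ~~ ((3 %| t1)%Z && (3 %| t2)%Z) ->
  (3 <= square_sum (bit_mismatch x t1 t2) (3 * u + a) (3 * w + b) 3)%N.
Proof.
move=> lift.
have [d1 [r [r3 ->]]] : exists (d : int) (r : nat), (r < 3)%N /\ t1 = 3 * d + r%:Z.
  by exists (t1 %/ 3)%Z, `|(t1 %% 3)%Z|%N; lia.
have [d2 [s [s3 ->]]] : exists (d : int) (r : nat), (r < 3)%N /\ t2 = 3 * d + r%:Z.
  by exists (t2 %/ 3)%Z, `|(t2 %% 3)%Z|%N; lia.
move=> nd; have rs0 : (r, s) != (0, 0)%N.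
  by apply: contraNneq nd => -[-> ->]; lia.
apply: leq_trans (@twist_mismatch r s (x' u w).2
  (fun k l => (x' (u + d1 + k%:Z) (w + d2 + l%:Z)).2) r3 s3 rs0) _.
apply/eq_leq/eq_bigr => i _; apply: eq_bigr => j _.
congr (nat_of_bool (_ != _)); rewrite -lift ?ltn_mod //; congr (x _ _).2; lia.
Qed.

(** A translation by a multiple of 3 preserves positions in blocks, so the twists cancel and each
    macro-mismatch counts 9 times. *)
Lemma mismatch_lift x x' a b (t1 t2 u w : int) (n : nat) :
  refines x x' a b ->
  square_sum (bit_mismatch x (3 * t1) (3 * t2)) (3 * u + a) (3 * w + b) (3 * n) =
  (9 * square_sum (bit_mismatch x' t1 t2) u w n)%N.
Proof.
move=> lift.
rewrite /square_sum (sum_ord_mul _ _ (fun i => \sum_(j < 3 * n)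
  bit_mismatch x (3 * t1) (3 * t2) (3 * u + a + i%:Z)%R (3 * w + b + j%:Z)%R)%N).
rewrite big_distrr; apply: eq_bigr => i _.
under eq_bigr => r _ do rewrite (sum_ord_mul _ _ (fun j =>
  bit_mismatch x (3 * t1) (3 * t2) (3 * u + a + (3 * i + r)%N%:Z)
    (3 * w + b + j%:Z) : nat)).
rewrite exchange_big big_distrr; apply: eq_bigr => j _ /=.
have nine (y : nat) : (9 * y = \sum_(r < 3) \sum_(s < 3) y)%N.
  by rewrite !sum_nat_const !card_ord mulnA.
rewrite nine; apply: eq_bigr => r _; apply: eq_bigr => s _.
congr nat_of_bool; rewrite /bit_mismatch.
have E (c d : int) (k l : nat) :
  3 * c + d + (3 * k + l)%N%:Z = 3 * (c + k%:Z) + l%:Z + d by lia.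
have E' (c d e : int) (k l : nat) :
  3 * c + d + (3 * k + l)%N%:Z + 3 * e = 3 * (c + k%:Z + e) + l%:Z + d by lia.
by rewrite !E' !E !lift // (inj_eq (can_inj (addbK _))).
Qed.

(** After [k] desubstitutions the translation is no longer divisible by 3, and one more gives
    [mismatch_block]; the density is 3 * 9 ^ k / 9 ^ (k + 1) = 1/3. *)
Lemma dense_blocks (k : nat) x h v (t1 t2 : int) : good x h v ->
  ~~ ((3 %| t1)%Z && (3 %| t2)%Z) ->
  exists a b : int, forall u w : int,
    (3 ^ k * 3 ^ k * 3 <= square_sum
      (bit_mismatch x ((3 ^ k)%N%:Z * t1) ((3 ^ k)%N%:Z * t2))
      ((3 ^ k.+1)%N%:Z * u + a) ((3 ^ k.+1)%N%:Z * w + b) (3 ^ k.+1))%N.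
Proof.
elim: k x h v => [|k IH] x h v G nd;
  have [a [b [x' [h' [v' [G' lift]]]]]] := desubstitute G.
  by exists a, b => u w; rewrite !mul1r !mul1n; apply: mismatch_block lift nd.
have [a' [b' H]] := IH _ _ _ G' nd.
exists (3 * a' + a), (3 * b' + b) => u w.
have E (m : nat) (c : int) : (3 ^ m.+1)%N%:Z * c = 3 * ((3 ^ m)%N%:Z * c).
  by rewrite expnS PoszM mulrA.
rewrite (E k t1) (E k t2) (E k.+1 u) (E k.+1 w) !addrA -!mulrDr.
rewrite [(3 ^ k.+2)%N]expnS (mismatch_lift _ _ _ _ _ lift).
by apply: leq_trans (leq_mul (leqnn 9) (H u w)); rewrite expnS; lia.
Qed.

Lemma three_adic (t1 t2 : int) : (t1, t2) <> (0, 0) ->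
  exists (k : nat) (s1 s2 : int),
    [/\ t1 = (3 ^ k)%N%:Z * s1, t2 = (3 ^ k)%N%:Z * s2
      & ~~ ((3 %| s1)%Z && (3 %| s2)%Z)].
Proof.
have [n] := ubnP (`|t1| + `|t2|)%N; elim: n t1 t2 => // n IH t1 t2 Hn t0.
have [/andP[/dvdzP[s1 E1] /dvdzP[s2 E2]]|nd] := boolP ((3 %| t1)%Z && (3 %| t2)%Z);
  last by exists 0%N, t1, t2; rewrite !mul1r.
have s0 : (s1, s2) <> (0, 0).
  by move=> [s10 s20]; apply: t0; rewrite E1 E2 s10 s20.
have nz : (0 < `|s1| + `|s2|)%N.
  by rewrite lt0n; apply/eqP => H; apply: s0; congr pair; lia.
have [|k [r1 [r2 [F1 F2 nd]]]] := IH s1 s2 _ s0; first by lia.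
by exists k.+1, r1, r2; rewrite E1 E2 F1 F2 expnS PoszM; split=> //; ring.
Qed.

(** * Existence of a tiling *)

(* For the tiling to be built, the block of macro-position u is centered at 3u:
   the origin is then the center of its own blocks at all levels. *)
Definition up (i : int) : int := ((i + 1) %/ 3)%Z.

Lemma absz_up i : (`|up i| <= `|i|)%N.
Proof. rewrite /up; lia. Qed.

Lemma absz_up_lt i : i != 0 -> (`|up i| < `|i|)%N.
Proof. rewrite /up; lia. Qed.

(** [up] strictly shrinks nonzero coordinates, so the recursion ends at the origin, where the
    hypothesis makes it consistent. *)
Lemma up_fixpoint (A : Type) (F : int -> int -> A -> A) (a : A) :
  F 0 0 a = a -> exists f, forall i j, f i j = F i j (f (up i) (up j)).
Proof.
move=> Fa.
pose fix f (n : nat) (i j : int) {struct n} : A :=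
  if n is n'.+1 then F i j (f n' (up i) (up j)) else a.
have f1 n i j : (`|i| + `|j| <= n)%N -> f n.+1 i j = f n i j.
  elim: n i j => [|n IH] i j Hn.
    have [-> ->] // : i = 0 /\ j = 0 by lia.
  suff /IH E : (`|up i| + `|up j| <= n)%N.
    by rewrite -[LHS]/(F i j (f n.+1 (up i) (up j))) E.
  by rewrite /up; lia.
have f2 n i j : (`|i| + `|j| <= n)%N -> f n i j = f (`|i| + `|j|)%N i j.
  move=> /subnK <-; elim: (n - _)%N => // d IH.
  by rewrite addSn f1 ?IH ?leq_addl.
exists (fun i j => f (`|i| + `|j|)%N i j) => i j.
by rewrite -f1 //= f2 // leq_add ?absz_up.
Qed.

Lemma up_pred i : (i + 1)%:~R != 0 :> 'Z_3 -> up (i - 1) = up i.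
Proof.
move=> H; suff : ~~ (3 %| i + 1)%Z by rewrite /up; lia.
apply: contra H => /dvdzP[q ->]; rewrite mulrC -[_ * _]addr0.
by rewrite (intr_Z3 q 0).
Qed.

Lemma up_pred0 i : (i + 1)%:~R = 0 :> 'Z_3 -> up (i - 1) = up i - 1.
Proof.
move=> H; suff : (3 %| i + 1)%Z by rewrite /up; lia.
have [q [r [r3 E]]] : exists (q : int) (r : nat), (r < 3)%N /\ i + 1 = 3 * q + r%:Z.
  by exists ((i + 1) %/ 3)%Z, `|((i + 1) %% 3)%Z|%N; lia.
move: H; rewrite E intr_Z3; case: r r3 {E} => [|[|[|]]] // _ _; lia.
Qed.

Lemma good_exists : exists x h v, good x h v.
Proof.
(* The shift by 1 gives the origin the central position (1, 1). *)
pose p i j : pos := ((i + 1)%:~R, (j + 1)%:~R).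
have [//|c Hc] := @up_fixpoint bool
  (fun i j b => b (+) twist (p i j).1 (p i j).2) false.
pose x i j : cell := (p i j, c i j).
have Ex i j : parent_bit (x i j) = c (up i) (up j).
  by rewrite /parent_bit /= Hc addbK.
(* On row 0 the wire is that of the macro-tile. The origin is off row 0 and fixed by [up], whence
   the initial value. *)
have [|h Hh] := @up_fixpoint wire (fun i j f =>
  if (j + 1)%:~R == 0 :> 'Z_3 then f else (p i j, x (up i) (up j))) (p 0 0, x 0 0).
  by [].
have [|v Hv] := @up_fixpoint wire (fun i j f =>
  if (i + 1)%:~R == 0 :> 'Z_3 then f else (p i j, x (up i) (up j))) (p 0 0, x 0 0).
  by [].
have lh i j : link_h (x (i - 1) j) (x i j) (v i j).
  rewrite /link_h /= /p /= addrAC rmorphB /= subrK eqxx /=.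
  apply/implyP => i0; rewrite Hv (negPf i0) /= !Ex (up_pred i0) !eqxx //.
have lv i j : link_v (x i (j - 1)) (x i j) (h i j).
  rewrite /link_v /= /p /= addrAC rmorphB /= subrK eqxx /=.
  apply/implyP => j0; rewrite Hh (negPf j0) /= !Ex (up_pred j0) !eqxx //.
have Hcore i j : p i j != (0, 0) ->
    core (p i j) (h (i - 1) j) (h i j) (v i j) (v i (j - 1)).
  move=> p0; have Np k : (k - 1 + 1)%:~R = (k + 1)%:~R - 1 :> 'Z_3.
    by rewrite addrAC rmorphB.
  apply/and4P; split=> //.
  - apply/implyP => /= j0.
    by rewrite (Hh i j) (Hh (i - 1) j) (negPf j0) /= /p Np !eqxx.
  - apply/implyP => /= i0.
    by rewrite (Hv i j) (Hv i (j - 1)) (negPf i0) /= /p Np !eqxx.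
  case: eqVneq => /= j0.
    have i0 : (i + 1)%:~R != 0 :> 'Z_3.
      by apply: contraNneq p0 => i0; rewrite /p i0 j0.
    rewrite (Hh i j) (Hh (i - 1) j) (Hv i j) (Hv i (j - 1)) j0 (negPf i0) /=.
    rewrite (up_pred i0) (up_pred0 j0) eqxx /=.
    exact: lv.
  case: eqVneq => /= i0.
    rewrite (Hh i j) (Hh (i - 1) j) (Hv i j) (Hv i (j - 1)) i0 (negPf j0) /=.
    rewrite (up_pred j0) (up_pred0 i0) eqxx /=.
    exact: lh.
  rewrite (Hh i j) (Hh (i - 1) j) (Hv i j) (Hv i (j - 1)) (negPf i0) (negPf j0).
  by rewrite /= (up_pred j0) (up_pred i0) !eqxx.
(* A tile at position (0, 0) has the four wires of its macro-tile; since [i] is nonzero there,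
   passing to [up] terminates. *)
have Hquad i j : exists p', core p' (h (i - 1) j) (h i j) (v i j) (v i (j - 1)).
  have [n] := ubnP (`|i| + `|j|)%N; elim: n i j => // n IH i j Hn.
  have [p0|/Hcore] := eqVneq (p i j) (0, 0); last by exists (p i j).
  have [i0 j0] := p0.
  have [|p' Hp'] := IH (up i) (up j).
    have iN0 : i != 0 by apply: contra_eq_neq i0 => ->.
    have := absz_up_lt iN0; have := absz_up j; lia.
  exists p'; rewrite (Hh (i - 1)) (Hh i) (Hv i j) (Hv i (j - 1)) i0 j0 !eqxx.
  by rewrite (up_pred0 i0) (up_pred0 j0).
exists x, h, v => i j; split=> //; rewrite /quad /=.
by have [p0|/Hcore//] := eqVneq (p i j) (0, 0); apply/existsP.
Qed.

(** * From aligned blocks to all large squares *)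

Theorem theorem4 :
  exists (C : finType) (tau : {set tile C}),
    (exists U : plane -> tile C, is_tiling tau U) /\
    (forall U : plane -> tile C, is_tiling tau U ->
     forall (R : realType) (alpha : R), 0 < alpha -> alpha < 1 / 3 ->
       aperiodic alpha U).
Proof.
exists color, tau; split.
  by have [x [h [v /good_tiling]]] := good_exists.
move=> U /tiling_good[x [h [v [G Ux]]]] R alpha alpha0 alpha3 [t1 t2] /three_adic.
move=> [k [s1 [s2 [E1 E2 /(dense_blocks k G)[a [b H]]]]]].
rewrite -E1 -E2 in H.
set M := (3 ^ k.+1)%N in H; set K := (3 ^ k * 3 ^ k * 3)%N in H.
have M0 : (0 < M)%N by rewrite expn_gt0.
have KM : (3 * K = M * M)%N by rewrite /K /M expnS; lia.
have d0 : 0 < 1 - 3 * alpha by lra.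
(* As (n - 2M)^2 <= 3c, it suffices that 4Mn < (1 - 3 alpha) n^2, that is [D < n]. *)
pose D : R := 4 * M%:R / (1 - 3 * alpha).
have D0 : 0 <= D by rewrite divr_ge0 ?mulr_ge0 ?ler0n // ltW.
exists (2 * M + Num.bound D)%N => n [p q] Hn.
have n0 : (0 < n)%N by lia.
rewrite /mismatch_fraction ltr_pdivlMr ?ltr0n ?expn_gt0 ?n0 //.
set A := [set _ | _]; set c := #|A|.
have Hc : (square_sum (bit_mismatch x t1 t2) p q n <= c)%N.
  have -> : (c = \sum_(i < n) \sum_(j < n) ((i, j) \in A))%N.
    rewrite pair_bigA /= /c -sum1_card big_mkcond /=.
    by apply: eq_bigr => -[i j] _ /=; case: (_ \in _).
  apply: leq_sum => i _; apply: leq_sum => j _.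
  rewrite inE /bit_mismatch /translate /square_point /= -!Ux.
  by case: eqP => // ne; case: eqP => // e; case: ne; rewrite e.
have Mn : (0 < M <= n)%N by lia.
have := leq_trans (square_sum_blocks H p q Mn) Hc.
set W := (n %/ M).-1 => HW.
(* One [M] pays for the rounding in [n %/ M], the other for the block lost to alignment. *)
have nW : (n <= M * W + 2 * M)%N.
  have := ltn_ceil n M0; have : (0 < n %/ M)%N by rewrite divn_gt0 //; lia.
  by rewrite /W; case: (n %/ M)%N => // w _; rewrite [w.+1.-1]/= !mulSn; lia.
have c3 : ((M * W) ^ 2 <= 3 * c)%N.
  rewrite (_ : (M * W) ^ 2 = 3 * (W * W * K))%N ?leq_mul2l ?HW ?orbT //.
  by rewrite mulnCA KM; lia.
have Dn : D < n%:R.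
  apply: lt_le_trans (archi_boundP D0) _; rewrite ler_nat; lia.
rewrite ltr_pdivrMr // in Dn.
have n0' : 0 < n%:R :> R by rewrite ltr0n.
move: c3 nW; rewrite -(ler_nat R) -(ler_nat R n) !natrX !natrM natrD !natrM => c3 nW.
have nM : 2 * M%:R <= n%:R :> R by rewrite -natrM ler_nat; lia.
have : (n%:R - 2 * M%:R) ^+ 2 <= (M%:R * W%:R) ^+ 2 :> R.
  by rewrite lerXn2r ?nnegrE ?subr_ge0 ?mulr_ge0 // lerBlDr.
move=> sq; have := le_trans sq c3.
have : (4 * M%:R) * n%:R < n%:R * (1 - 3 * alpha) * n%:R by rewrite ltr_pM2r.
have : 0 <= (2 * M%:R) ^+ 2 :> R by apply: sqr_ge0.
rewrite natrX; lra.
Qed.
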